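(* For every fixed real $C>0$, \[ \max_{m\in\mathbb{N},\ m\le n^{C}} f(n,m)\ \le\ n^{1+o(1)}\qquad(n\to\infty). \]
   Context: $\mathbb{N}=\{1,2,3,\ldots\}$. For $n,m\in\mathbb{N}$, $f(n,m)$ denotes the least nonnegative integer $h$ such that the interval $(m,m+h]$ contains pairwise distinct integers $a_1,\ldots,a_n$ with $i\mid a_i$ for all $1\le i\le n$ (such an $h$ always exists). The term $o(1)$ is a quantity tending to $0$ as $n\to\infty$ with $C$ fixed; it may depend on $C$. That is, for every $C>0$ and every $\varepsilon>0$ there is $n_0$ such that $f(n,m)\le n^{1+\varepsilon}$ for all $n\ge n_0$ and all $m\in\mathbb{N}$ with $m\le n^{C}$. *)

(* Defs.v *)
From HB Require Import structures.
From mathcomp Require Import all_boot all_order all_algebra.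
From mathcomp Require Import all_classical all_reals all_analysis.
Set Implicit Arguments.
Unset Strict Implicit.
Unset Printing Implicit Defensive.

(* The index i : 'I_n stands for the divisor i.+1, so divisors run over 1..n. *)
Definition admissible (n m h : nat) : Prop :=
  exists a : 'I_n -> nat,
    injective a /\ forall i : 'I_n, m < a i <= m + h /\ i.+1 %| a i.

Lemma admissible_exists (n m : nat) : exists h, `[< admissible n m h >].
Proof.
exists (n * m.+1); apply/asboolP; exists (fun i => i.+1 * m.+1); split.
  by move=> i j /eqP; rewrite eqn_pmul2r // eqSS => /eqP /val_inj.
move=> i; split; last exact: dvdn_mulr.
rewrite leq_pmull //=; apply: leq_trans (leq_addl _ _).
by rewrite leq_mul2r ltn_ord orbT.
Qed.

Definition f (n m : nat) : nat := ex_minn (admissible_exists n m).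

(* Main.v *)
(* The integers a <= m + h at hand are polynomially bounded in n, so each has
   at most n^eps divisors by the divisor bound, whereas for h = n^(1+eps) each
   i <= n has at least floor(h/n) ~ n^eps multiples in (m, m+h].  Double counting
   incidences gives Hall's condition, hence a system of distinct multiples.  The
   divisor bound is used in the integral form d(a)^k <= M_k a: the factor
   (e+1)^k contributed by p^e is at most 2^(ke) <= p^e when p >= 2^k, and at
   most k^k p^e for the boundedly many smaller primes. *)
Require Import Defs.
From mathcomp Require Import all_boot all_order all_algebra.
From mathcomp Require Import all_classical all_reals all_analysis.
From mathcomp Require Import zify ring.
Import Order.TTheory GRing.Theory Num.Theory.
Set Implicit Arguments.
Unset Strict Implicit.
Unset Printing Implicit Defensive.

(** Rado's proof, by induction on the total size of the sets. If no [N i] has two elements, all are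
    singletons, and Hall's condition on pairs makes them distinct. Otherwise one of two elements
    [a], [b] of some [N i] can be deleted without breaking Hall's condition. *)
Lemma hall_marriage (I A : finType) (N : I -> {set A}) :
  (forall J : {set I}, #|J| <= #|\bigcup_(i in J) N i|) ->
  exists2 g : I -> A, injective g & forall i, g i \in N i.
Proof.
have [s] := ubnP (\sum_i #|N i|); elim: s N => // s IHs N ltNs hallN.
have [/existsP [i /card_gt1P [a [b [Na Nb neq_ab]]]]|small] :=
    boolP [exists i, 1 < #|N i|]; last first.
  have N1 i : exists x, N i == [set x].
    suff /cards1P [x ->] : #|N i| == 1 by exists x.
    move: small; rewrite negb_exists => /forallP /(_ i); rewrite -leqNgt.
    by rewrite eqn_leq => ->; have := hallN [set i]; rewrite cards1 big_set1.
  have [g Ng] : {g : I -> A | forall i, N i = [set g i]}.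
    by exists (fun i => xchoose (N1 i)) => i; apply/eqP/(xchooseP (N1 i)).
  exists g => [i j eq_g|i]; last by rewrite Ng set11.
  apply/eqP; apply: contraT => neq_ij.
  have := hallN [set i; j]; rewrite cards2 neq_ij big_setU1 ?inE //= big_set1.
  by rewrite !Ng eq_g finset.setUid cards1.
pose del x j := if j == i then N i :\ x else N j.
have delS x j : del x j \subset N j.
  by rewrite /del; case: eqP => // ->; rewrite finset.subD1set.
(* A set violating Hall's condition after the deletion must contain [i], since the other
   neighbourhoods are unchanged. *)
have del_or x : x \in N i ->
    (exists2 g : I -> A, injective g & forall j, g j \in N j) \/
    exists2 J : {set I}, i \in J & #|\bigcup_(j in J) del x j| < #|J|.
  move=> Nx.
  have [/existsP [J ltJ]|hall_del] :=
      boolP [exists J : {set I}, #|\bigcup_(j in J) del x j| < #|J|].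
    right; exists J => //; apply: contraLR ltJ => iJ; rewrite -leqNgt.
    apply: leq_trans (hallN J) _; rewrite leq_eqVlt; apply/orP; left.
    apply/eqP; congr #|pred_of_set _|; apply: eq_bigr => j jJ.
    by rewrite /del; case: eqP => // eq_ji; rewrite -eq_ji jJ in iJ.
  left; have [||g g_inj gN] := IHs (del x).
  - apply: leq_trans (_ : \sum_j #|N j| <= s) => //.
    rewrite (bigD1 i) // [X in _ < X](bigD1 i) //=.
    rewrite {1}/del eqxx (cardsD1 x (N i)) Nx add1n addSn ltnS leq_add2l.
    by apply: leq_sum => j _; apply: subset_leq_card.
  - move=> J; rewrite leqNgt.
    by move: hall_del; rewrite negb_exists => /forallP /(_ J).
  - by exists g => // j; apply: (fintype.subsetP (delS x j)).
have [//|[J iJ ltJ]] := del_or a Na; have [//|[K iK ltK]] := del_or b Nb.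
(* Submodularity: the deficient sets J and K of the two deletions would
   force a deficiency of N at J :|: K or at (J :&: K) :\ i. *)
set P := \bigcup_(j in J) _ in ltJ; set Q := \bigcup_(j in K) _ in ltK.
have sub_cup : \bigcup_(j in J :|: K) N j \subset P :|: Q.
  apply/finset.bigcupsP => j jJK; apply/fintype.subsetP => x Nx.
  have [eq_ji|neq_ji] := eqVneq j i.
    rewrite eq_ji in Nx; rewrite inE; have [->|neq_xa] := eqVneq x a.
      by apply/orP; right; apply/finset.bigcupP; exists i;
        rewrite // /del eqxx !inE neq_ab.
    by apply/orP; left; apply/finset.bigcupP; exists i; rewrite // /del eqxx !inE neq_xa.
  case/setUP: jJK => jX; rewrite inE; apply/orP; [left|right];
    by apply/finset.bigcupP; exists j; rewrite // /del (negPf neq_ji).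
have sub_cap : \bigcup_(j in (J :&: K) :\ i) N j \subset P :&: Q.
  apply/finset.bigcupsP => j; rewrite !inE => /and3P [/negPf neq_ji jJ jK].
  apply/fintype.subsetP => x Nx.
  by rewrite inE; apply/andP; split; apply/finset.bigcupP; exists j;
    rewrite // /del neq_ji.
(* In total |J ∪ K| + |J ∩ K| - 1 <= |P| + |Q| <= |J| + |K| - 2, which is absurd. *)
have := leq_trans (hallN _) (subset_leq_card sub_cup).
have := leq_trans (hallN _) (subset_leq_card sub_cap).
have := cardsUI P Q; have := cardsUI J K.
rewrite (cardsD1 i (J :&: K)) inE iJ iK /=; lia.
Qed.

(** With q = floor(e/k), e + 1 <= k(q + 1) <= k 2^q, and qk <= e. This handles the primes below
    2^k. *)
Lemma succ_exp_leq (k e : nat) : 0 < k -> e.+1 ^ k <= k ^ k * 2 ^ e.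
Proof.
move=> k_gt0; apply: leq_trans (_ : (k * 2 ^ (e %/ k)) ^ k <= _).
  rewrite leq_exp2r //; apply: leq_trans (_ : k * (e %/ k).+1 <= _).
    by rewrite mulnC ltn_ceil.
  by rewrite leq_mul2l ltn_expl ?orbT.
by rewrite expnMn -expnM leq_mul2l leq_pexp2l ?leq_divM ?orbT.
Qed.

(** Every divisor of [a] is a power of [p], with exponent at most [logn p a], times a divisor of the
    part of [a] prime to [p]. *)
Lemma size_divisors_logn_part (p a : nat) : prime p -> 0 < a ->
  size (divisors a) <= (logn p a).+1 * size (divisors a`_p^').
Proof.
move=> p_pr a_gt0.
have -> : (logn p a).+1 * size (divisors a`_p^') =
    size [seq p ^ i * d | i <- iota 0 (logn p a).+1, d <- divisors a`_p^'].
  by rewrite size_allpairs size_iota.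
apply: uniq_leq_size (divisors_uniq _) _ => d; rewrite -dvdn_divisors // => dvd_d.
have d_gt0 := dvdn_gt0 a_gt0 dvd_d.
apply/allpairsP; exists (logn p d, d`_p^'); split.
- by rewrite mem_iota leq0n add0n ltnS dvdn_leq_log.
- by rewrite -dvdn_divisors ?part_gt0 // partn_dvd.
- by rewrite -p_part partnC.
Qed.

(** Strong induction on [a], splitting off the full power of its least prime factor. Keeping the
    number of small primes of [a] in the exponent lets the induction charge [k ^ k] once for each of
    them. *)
Lemma divisor_bound_primes (k a : nat) : 0 < k -> 0 < a ->
  size (divisors a) ^ k <=
    (k ^ k) ^ size [seq p <- primes a | p < 2 ^ k] * a.
Proof.
move=> k_gt0; have [s] := ubnP a; elim: s a => // s IHs a lt_as a_gt0.
have kk_gt0 : 0 < k ^ k by rewrite expn_gt0 k_gt0.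
have [a_le1|a_gt1] := leqP a 1.
  by have -> : a = 1 by [lia]; rewrite exp1n.
pose p := pdiv a; have p_pr : prime p := pdiv_prime a_gt1.
have p_dv : p %| a := pdiv_dvd a.
set b := a`_p^'; have b_gt0 : 0 < b by apply: part_gt0.
pose e := logn p a; have def_a : a = p ^ e * b by rewrite -p_part partnC.
have e_gt0 : 0 < e by rewrite logn_gt0 mem_primes p_pr a_gt0.
have lt_ba : b < a.
  by rewrite def_a ltn_Pmull // -(expn0 p) ltn_exp2l ?prime_gt1.
have p'b : p \notin primes b.
  by rewrite primes_part mem_filter !inE eqxx.
apply: leq_trans (_ : (e.+1 * size (divisors b)) ^ k <= _).
  by rewrite leq_exp2r // size_divisors_logn_part.
rewrite expnMn; apply: leq_trans (leq_mul (leqnn _) (IHs b _ b_gt0)) _.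
  exact: leq_trans lt_ba _.
set small := fun q => q < 2 ^ k; rewrite -/small.
have le_small : size [seq q <- p :: primes b | small q] <=
    size [seq q <- primes a | small q].
  apply: uniq_leq_size; first by rewrite filter_uniq //= p'b primes_uniq.
  move=> q; rewrite !mem_filter inE => /andP [-> /orP [/eqP ->|]] /=.
    by rewrite mem_primes p_pr a_gt0.
  by rewrite primes_part mem_filter => /andP [].
apply: leq_trans
  (_ : (k ^ k) ^ size [seq q <- p :: primes b | small q] * a <= _); last first.
  by rewrite leq_mul2r leq_pexp2l ?orbT.
have kp : e.+1 ^ k <= (if small p then k ^ k else 1) * p ^ e.
  rewrite /small; case: ltnP => [_|le_p].
    apply: leq_trans (succ_exp_leq e k_gt0) _.
    by rewrite leq_mul2l leq_exp2r // prime_gt1 ?orbT.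
  rewrite mul1n; apply: leq_trans (_ : (2 ^ k) ^ e <= _).
    by rewrite -expnM mulnC expnM leq_exp2r // ltn_expl.
  by rewrite leq_exp2r.
rewrite def_a mulnCA.
apply: leq_trans (leq_mul (leqnn _) (leq_mul kp (leqnn _))) _.
rewrite /= -mulnA mulnA leq_mul2r; apply/orP; right.
by case: (small p); rewrite ?muln1 // expnS mulnC.
Qed.

Lemma divisor_bound (k : nat) : 0 < k ->
  exists M, forall a, 0 < a -> size (divisors a) ^ k <= M * a.
Proof.
move=> k_gt0; have kk_gt0 : 0 < k ^ k by rewrite expn_gt0 k_gt0.
(* Fewer than 2^k primes lie below 2^k, so the exponent is bounded independently of [a]. *)
exists ((k ^ k) ^ 2 ^ k) => a a_gt0.
apply: leq_trans (divisor_bound_primes k_gt0 a_gt0) _.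
rewrite leq_mul2r leq_pexp2l ?orbT // -[X in _ <= X](size_iota 0).
apply: uniq_leq_size; first by rewrite filter_uniq ?primes_uniq.
by move=> p; rewrite mem_filter mem_iota => /andP [].
Qed.

(** The multiples i(floor(m/i) + 1), ..., i(floor(m/i) + q) all exceed m, and the last is at most m
    + iq <= m + h. *)
Lemma card_multiples_interval (m h i : nat) (N : {set 'I_(m + h).+1}) (q : nat) :
  0 < i -> i * q <= h ->
  (forall a : 'I_(m + h).+1, m < a -> i %| a -> a \in N) -> q <= #|N|.
Proof.
move=> i_gt0 le_iq_h inN; pose mult (j : 'I_q) := i * (m %/ i + j.+1).
have lt_m j : m < mult j.
  by rewrite /mult addnS mulnC -ltn_divLR // ltnS leq_addr.
have le_mh j : mult j < (m + h).+1.
  rewrite ltnS /mult mulnDr leq_add ?[i * _]mulnC ?leq_divM //.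
  by apply: leq_trans le_iq_h; rewrite mulnC leq_mul2l ltn_ord orbT.
rewrite -[q]card_ord -cardsT.
rewrite -(@card_imset _ _ (fun j => Ordinal (le_mh j))) => [|j1 j2 [] /eqP].
  apply/subset_leq_card/fintype.subsetP => _ /imsetP [j _ ->].
  by apply: inN; [apply: lt_m | apply: dvdn_mulr].
by rewrite eqn_pmul2l // eqn_add2l eqSS => /eqP /val_inj.
Qed.

Lemma admissible_of_divisors (n m h : nat) : n <= h ->
  (forall a, 0 < a <= m + h -> size (divisors a) * n <= h) ->
  admissible n m h.
Proof.
have [->|n_gt0] := posnP n.
  by exists (fun=> 0); split => [[]|[]].
move=> le_nh div_le; pose N (i : 'I_n) :=
  [set a : 'I_(m + h).+1 | (m < a) && (i.+1 %| a)].
pose q := h %/ n; have q_gt0 : 0 < q by rewrite divn_gt0.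
have [J|g g_inj gN] := @hall_marriage _ _ N.
  (* Hall's condition is proved multiplied by [q]: the incidences between [J] and [U] number at
     least |J| q, and at most |U| q once counted from the side of [U]. *)
  rewrite -(leq_pmul2r q_gt0); set U := \bigcup_(i in J) N i.
  apply: leq_trans (_ : \sum_(i in J) #|N i| <= _).
    rewrite -sum_nat_const; apply: leq_sum => i _.
    apply: (@card_multiples_interval m h i.+1) => // [|a lt_ma dvd_a].
      by apply: leq_trans (leq_divM h n); rewrite mulnC leq_mul2l ltn_ord orbT.
    by rewrite inE lt_ma.
  apply: leq_trans (_ : \sum_(i in J) \sum_(a in U | a \in N i) 1 <= _).
    apply: leq_sum => i iJ; rewrite sum1_card; apply/subset_leq_card/fintype.subsetP => a.
    by move=> Na; apply/andP; split=> //; apply/finset.bigcupP; exists i.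
  rewrite (exchange_big_dep (mem U)) /=; last by move=> ? ? _ /andP [].
  rewrite -sum_nat_const; apply: leq_sum => a aU.
  have lt_ma : m < a by case/finset.bigcupP: aU => i _; rewrite inE => /andP [].
  have a_gt0 : 0 < a by apply: leq_ltn_trans lt_ma.
  rewrite sum1_card /q leq_divRL //.
  apply: leq_trans (div_le a _); last by rewrite a_gt0 -ltnS ltn_ord.
  rewrite leq_mul2r; apply/orP; right.
  (* The indices [i] adjacent to [a] inject into the divisors of [a] by [i.+1]. *)
  rewrite cardE -(size_map (fun i : 'I_n => i.+1)).
  apply: uniq_leq_size => [|d /mapP [i]].
    by rewrite map_inj_uniq ?enum_uniq // => i j [] /val_inj.
  rewrite mem_enum => /and3P [_ _]; rewrite inE => /andP [_ dvd_a] ->.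
  by rewrite -dvdn_divisors.
exists (fun i => val (g i : 'I_(m + h).+1)); split => [i j /val_inj /g_inj //|i].
by have := gN i; rewrite inE => /andP [-> ->]; rewrite -ltnS ltn_ord.
Qed.

Lemma f_le_admissible (n m h : nat) : admissible n m h -> f n m <= h.
Proof.
by move=> adm; rewrite /f; case: ex_minnP => h0 _; apply; apply/asboolP.
Qed.

Local Open Scope ring_scope.

Theorem proposition6p2 (R : realType) (C : R) (hC : 0 < C)
    (eps : R) (heps : 0 < eps) :
  exists n0 : nat, forall n : nat, (0 < n)%N -> (n0 <= n)%N ->
    forall m : nat, (0 < m)%N -> m%:R <= n%:R `^ C :> R ->
      (f n m)%:R <= n%:R `^ (1 + eps) :> R.
Proof.
(* Chosen so that n^(C + 2 + eps), which will bound [M * a], is at most n^(k eps). *)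
have [k ltk] : exists k : nat, (C + 2 + eps) / eps < k%:R.
  by exists (Num.truncn ((C + 2 + eps) / eps)).+1; apply: truncnS_gt.
have s_gt0 : 0 < C + 2 + eps by rewrite !addr_gt0.
have k_gt0 : (0 < k)%N.
  by rewrite -(ltr0n R); apply: lt_trans ltk; rewrite divr_gt0.
rewrite ltr_pdivrMr // in ltk.
have [M divM] := divisor_bound k_gt0.
(* One factor n of n^(C + 2 + eps) absorbs both [M] and the 2 from m + h <= 2 n^(C + 1 + eps). *)
exists (2 * M)%N => n n_gt0 le_n m m_gt0 le_m.
have n_ge1 : 1 <= n%:R :> R by rewrite ler1n.
have n_pos : 0 < n%:R :> R by rewrite ltr0n.
have powD (x y : R) : n%:R `^ (x + y) = n%:R `^ x * n%:R `^ y.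
  by rewrite powRD // pnatr_eq0 -lt0n n_gt0 implybT.
have pow_gt0 (x : R) : 0 < n%:R `^ x by rewrite powR_gt0.
set H := n%:R `^ (1 + eps); pose h := Num.truncn H.
have H_ge0 : 0 <= H by apply: powR_ge0.
have le_hH : h%:R <= H by rewrite truncn_le.
apply: le_trans (_ : h%:R <= _) => //; rewrite ler_nat; apply: f_le_admissible.
(* An integer is at most [h] exactly when it is at most [H], so rounding down loses nothing. *)
apply: admissible_of_divisors => [|a /andP [a_gt0 le_a]]; rewrite truncn_ge_nat //.
  by rewrite -[leLHS]powRr1 // ler_powR // lerDl ltW.
rewrite natrM mulrC /H powD powRr1 // ler_pM2l //.
(* The remaining bound d(a) <= n^eps is raised to the power [k] to match [divM]. *)
rewrite -(@ler_pXn2r _ k) // ?nnegrE ?powR_ge0 //.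
rewrite -[leRHS]powR_mulrn ?powR_ge0 // -powRrM [eps * _]mulrC.
apply: le_trans (_ : n%:R `^ (C + 2 + eps) <= _); last by rewrite ler_powR // ltW.
rewrite -natrX; apply: le_trans (_ : (M * a)%:R <= _).
  by rewrite ler_nat; apply: divM.
have le_a2 : a%:R <= 2 * n%:R `^ (C + (1 + eps)) :> R.
  apply: le_trans (_ : (m + h)%:R <= _); first by rewrite ler_nat.
  rewrite natrD mulr_natl mulr2n lerD //.
    by apply: le_trans le_m _; rewrite ler_powR // lerDl addr_ge0 ?ltW.
  by apply: le_trans le_hH _; rewrite ler_powR // lerDr ltW.
have -> : C + 2 + eps = 1 + (C + (1 + eps)) by ring.
rewrite powD powRr1 // natrM.
apply: le_trans (_ : M%:R * (2 * n%:R `^ (C + (1 + eps))) <= _).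
  by apply: ler_wpM2l.
by rewrite mulrA ler_pM2r // -natrM ler_nat mulnC.
Qed.
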